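(* Let $X$ be a compact Hausdorff space and $E$ a unital Banach algebra. Let $H:C(X,E)\to C(X,E)$ be a strongly subadditive map with constant $M>0$. Suppose that: (i) for each $f\in C(X,E)$ there exists $\epsilon>0$ such that $\|Hf-f\|<\epsilon$; (ii) there exists $c>0$ such that $0<cM<1$ and $\|Hf\|\le c\|f\|$ for all $f\in C(X,E)$. Then $H$ has a unique fixed point $f_0\in C(X,E)$, and $\lim_{n\to\infty}H^nf=f_0$ for every $f\in C(X,E)$.
   Context: $C(X,E)$ is the space of continuous functions $X\to E$ with the supremum norm $\|f\|=\sup_{x\in X}\|f(x)\|$. A map $H:C(X,E)\to C(X,E)$ (not assumed linear) is subadditive if $\|H(f+g)\|\le\|Hf\|+\|Hg\|$ for all $f,g\in C(X,E)$. A subadditive map $H$ is strongly subadditive with constant $M>0$ if for each $f\in C(X,E)$ there exists $\varepsilon>0$ such that $\|Hf-Hg\|\le M\|H(f-g)\|$ for all $g\in C(X,E)$ with $\|f-g\|<\varepsilon$ (here $M$ does not depend on $f$ or $g$). $H^n$ denotes the $n$-fold iterate of $H$. *)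

(* Defs.v *)
From HB Require Import structures.
From mathcomp Require Import all_boot all_order all_algebra complex.
From mathcomp Require Import all_classical all_reals all_analysis.

Set Implicit Arguments.
Unset Strict Implicit.
Unset Printing Implicit Defensive.

Import Order.TTheory GRing.Theory Num.Theory.
Import numFieldNormedType.Exports.

Local Open Scope classical_set_scope.
Local Open Scope ring_scope.

Definition real_or_complex (K : numFieldType) : Prop :=
  exists R : realType, K = R :> numFieldType \/ K = R[i] :> numFieldType.

(* A record on top of [completeNormedModType] rather than a join with
   [GRing.Algebra]: the library has no structure below [Num.NumDomain] joining
   the norm and the semiring hierarchies, so Hierarchy Builder refuses the join.
   The normalisation [`|1| = 1] required by some authors is not imposed. *)
Record unitalBanachAlgebra (K : numFieldType) := UnitalBanachAlgebra {
  banach_space :> completeNormedModType K;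
  banach_mul : banach_space -> banach_space -> banach_space;
  banach_one : banach_space;
  banach_mulA : associative banach_mul;
  banach_mul1l : left_id banach_one banach_mul;
  banach_mul1r : right_id banach_one banach_mul;
  banach_mulDl : left_distributive banach_mul +%R;
  banach_mulDr : right_distributive banach_mul +%R;
  banach_scaleAl : forall (a : K) (x y : banach_space),
    banach_mul (a *: x) y = a *: banach_mul x y;
  banach_scaleAr : forall (a : K) (x y : banach_space),
    banach_mul x (a *: y) = a *: banach_mul x y;
  banach_normM : forall x y : banach_space,
    `|banach_mul x y| <= `|x| * `|y|
}.

Section ContinuousZmodule.
Context {K : numFieldType} {X : topologicalType} {E : normedModType K}.
Implicit Types f g : continuousType X E.

Let cts_zero : continuous (0 : X -> E).
Proof. exact: cst_continuous. Qed.

Let cts_opp f : continuous (- (f : X -> E)).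
Proof. by move=> x; apply: cvgN; exact: cts_fun. Qed.

Let cts_add f g : continuous ((f : X -> E) + (g : X -> E)).
Proof. by move=> x; apply: cvgD; exact: cts_fun. Qed.

Definition ctsf_zero : continuousType X E := mkcts cts_zero.
Definition ctsf_opp f : continuousType X E := mkcts (@cts_opp f).
Definition ctsf_add f g : continuousType X E := mkcts (@cts_add f g).

Let ctsf_addA : associative ctsf_add.
Proof. by move=> f g h; apply/continuousEP => x; exact: addrA. Qed.
Let ctsf_addC : commutative ctsf_add.
Proof. by move=> f g; apply/continuousEP => x; exact: addrC. Qed.
Let ctsf_add0 : left_id ctsf_zero ctsf_add.
Proof. by move=> f; apply/continuousEP => x; exact: add0r. Qed.
Let ctsf_addN : left_inverse ctsf_zero ctsf_opp ctsf_add.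
Proof. by move=> f; apply/continuousEP => x; exact: addNr. Qed.

HB.instance Definition _ := GRing.isZmodule.Build (continuousType X E)
  ctsf_addA ctsf_addC ctsf_add0 ctsf_addN.

End ContinuousZmodule.

Section SupNorm.
Context {K : numFieldType} {X : topologicalType} {E : normedModType K}.
Implicit Types (f g : continuousType X E)
  (H : continuousType X E -> continuousType X E) (M : K).

(* The supremum is taken in the order of [K], which for [K = R[i]] only compares
   elements with equal imaginary parts; norms are nonnegative there.  By
   [sup_normP] below this is the usual supremum when [K] is [R] or [R[i]] and
   [X] is compact and nonempty; it is [0] when [X] is empty. *)
Definition sup_norm f : K := supremum 0 (range (fun x : X => `|f x|)).

Definition subadditive_map H : Prop :=
  forall f g, sup_norm (H (f + g)) <= sup_norm (H f) + sup_norm (H g).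

Definition strongly_subadditive M H : Prop :=
  subadditive_map H /\
  forall f, exists2 e : K, 0 < e &
    forall g, sup_norm (f - g) < e ->
      sup_norm (H f - H g) <= M * sup_norm (H (f - g)).

End SupNorm.

Lemma nneg_supremums (K : numFieldType) (A : set K) : real_or_complex K ->
  A !=set0 -> A `<=` [set y | 0 <= y] -> has_ubound A -> supremums A !=set0.
Proof.
move=> -[R [] KE]; subst K => -[a Aa] A0 [b Ab].
  exists (sup A); split.
    by apply: sup_upper_bound; split; [exists a|exists b].
  by move=> y Ay; apply: ge_sup => //; exists a.
pose B := [set complex.Re z | z in A].
have im0 z : A z -> z = (complex.Re z)%:C%C.
  by move=> /A0; case: z => x y; rewrite /= lecE /= => /andP[/eqP -> _].
have Bub z : ubound A z -> ubound B (complex.Re z).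
  by move=> Az _ [w Aw <-]; have := Az _ Aw; rewrite lecE => /andP[].
have hB : has_sup B by split; [exists (complex.Re a), a|exists (complex.Re b); exact: Bub].
exists (sup B)%:C%C; split.
  move=> z Az; rewrite (im0 _ Az) lecR; apply: sup_upper_bound => //.
  by exists z.
move=> z Az; have := Az _ Aa; rewrite lecE => /andP[/eqP imz _].
rewrite lecE /= imz (im0 _ Aa) /= eqxx /=.
by apply: ge_sup; [exists (complex.Re a), a|exact: Bub].
Qed.

Lemma sup_normP (K : numFieldType) (X : topologicalType) (E : normedModType K)
    (f : continuousType X E) :
  real_or_complex K -> compact [set: X] -> [set: X] !=set0 ->
  supremums (range (fun x : X => `|f x|)) (sup_norm f).
Proof.
move=> hK cX [x0 _]; rewrite /sup_norm /supremum ifF; last first.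
  by apply/negbTE/set0P; exists `|f x0|, x0.
apply: xgetPex; apply: nneg_supremums => //.
- by exists `|f x0|, x0.
- by move=> _ [x _ <-] /=.
have ncX : near_covering [set: X] by apply/compact_near_coveringP.
have bdd : \forall M \near (+oo : set_system K),
    [set: X] `<=` (fun M x => `|f x| <= M) M.
  apply: ncX => x _; exists
    ([set y | `|f x - f y| <= 1], [set M | `|f x| + 1 <= M]) => /=; last first.
    move=> [y M] /= [fxy fxM]; apply: le_trans fxM.
    by rewrite -[f y](subKr (f x)) (le_trans (ler_normB _ _))// lerD2l.
  split; last by apply: nbhs_pinfty_ge; rewrite realD.
  by have /cvgrPdist_le/(_ 1 ltr01) := @cts_fun _ _ f x.
have [M fM] := filter_ex bdd.
by exists M => _ [x _ <-]; exact: fM.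
Qed.

(* Main.v *)
(* Since [H 0 = 0], strong subadditivity at [0] gives [|H g| <= c M |g|] for
   [g] near [0].  Subadditivity propagates this to every [f]:
   [|H f| <= n |H (f / n)| <= c M |f|] for large [n].  As [c M < 1], the
   iterates of [H] tend to [0], which is therefore the only fixed point. *)

Require Import Defs.
From HB Require Import structures.
From mathcomp Require Import all_boot all_order all_algebra complex.
From mathcomp Require Import all_classical all_reals all_analysis.

Set Implicit Arguments.
Unset Strict Implicit.
Unset Printing Implicit Defensive.

Import Order.TTheory GRing.Theory Num.Theory.
Import numFieldNormedType.Exports.

Local Open Scope classical_set_scope.
Local Open Scope ring_scope.

Section RealOrComplex.
Variables (K : numFieldType) (hK : real_or_complex K).

(** In [R[i]], [0 <= x] forces the imaginary part to vanish, so both cases rest on the Archimedean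
    property of [R]. *)
Lemma real_or_complex_archi (x : K) : 0 <= x -> exists n : nat, x < n%:R.
Proof.
case: hK => R [] KE; subst K => x0.
  by exists (Num.bound x); exact: archi_boundP.
case: x x0 => a b; rewrite lecE /= => /andP[/eqP -> a0].
exists (Num.bound a); rewrite -(rmorph_nat (@real_complex R)) ltcR.
exact: archi_boundP.
Qed.

(** Bernoulli's inequality for [k^-1 = 1 + (k^-1 - 1)] makes [k^-1 ^+ n] grow at least linearly; the
    Archimedean property then lets it exceed [a / e]. This treats the real and complex cases at
    once. *)
Lemma real_or_complex_cvg_geometric (a k : K) : 0 <= a -> 0 < k < 1 ->
  a * k ^+ n @[n --> \oo] --> (0 : K).
Proof.
move=> a0 /andP[k0 k1]; apply/cvgrPdist_lt => e e0.
have d0 : 0 < k^-1 - 1 by rewrite subr_gt0 invf_gt1.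
have bernoulli n : n%:R * (k^-1 - 1) <= k^-1 ^+ n.
  elim: n => [|n IHn]; first by rewrite mul0r.
  have k1n : 1 <= k^-1 ^+ n by rewrite exprn_ege1// -subr_ge0 ltW.
  have -> : k^-1 ^+ n.+1 = k^-1 ^+ n + (k^-1 - 1) * k^-1 ^+ n.
    by rewrite mulrBl mul1r addrC subrK exprS.
  rewrite -natr1 mulrDl mul1r.
  by apply: lerD => //; rewrite ler_peMr// ltW.
(* For [n >= N] this gives [a < e * (n%:R * (k^-1 - 1)) <= e * k^-1 ^+ n]. *)
have [N aN] : exists N : nat, a / (e * (k^-1 - 1)) < N%:R.
  by apply: real_or_complex_archi; rewrite divr_ge0// mulr_ge0// ltW.
exists N => // n /= Nn.
have kn0 : 0 < k ^+ n by rewrite exprn_gt0.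
rewrite sub0r normrN ger0_norm ?mulr_ge0 ?(ltW kn0)//.
rewrite -ltr_pdivlMr// -exprVn.
apply: lt_le_trans (ler_wpM2l (ltW e0) (bernoulli n)).
rewrite mulrCA -ltr_pdivrMr ?mulr_gt0//.
by apply: lt_le_trans aN _; rewrite ler_nat.
Qed.

Variables (X : topologicalType) (X_compact : compact [set: X]).
Variable E : normedModType K.
Implicit Types f g : continuousType X E.

Lemma sup_norm_ub f x : `|f x| <= sup_norm f.
Proof.
have [] := sup_normP f hK X_compact; first by exists x.
by move=> fub _; apply: fub; exists x.
Qed.

(** The hypothesis [0 <= C] serves the empty space, where [sup_norm f] takes the default value [0]
    and the pointwise bound is vacuous. *)
Lemma sup_norm_le f (C : K) :
  0 <= C -> (forall x, `|f x| <= C) -> sup_norm f <= C.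
Proof.
move=> C0 fC; have [X0|/set0P X0] := eqVneq [set: X] set0.
  by rewrite /sup_norm X0 image_set0 /supremum eqxx.
have [_] := sup_normP f hK X_compact X0; apply.
by move=> _ [x _ <-]; exact: fC.
Qed.

Lemma sup_norm_ge0 f : 0 <= sup_norm f.
Proof.
have [X0|/set0P[x _]] := eqVneq [set: X] set0.
  by rewrite /sup_norm X0 image_set0 /supremum eqxx.
exact: le_trans (sup_norm_ub f x).
Qed.

Lemma sup_norm0 : sup_norm (0 : continuousType X E) = 0.
Proof.
apply/eqP; rewrite eq_le sup_norm_ge0 andbT.
by apply: sup_norm_le => // x; rewrite normr0.
Qed.

Lemma sup_norm_eq0 f : sup_norm f <= 0 -> f = 0.
Proof.
move=> f0; apply/continuousEP => x; apply/normr0_eq0/eqP.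
by rewrite eq_le normr_ge0 andbT (le_trans (sup_norm_ub f x)).
Qed.

Lemma sup_normN f : sup_norm (- f) = sup_norm f.
Proof.
by congr (supremum 0 _); apply: eq_imagel => x _; exact: normrN.
Qed.

(** The witness is [f / n], scaled pointwise in [E]; writing [f] as an [n]-fold sum is the form to
    which subadditivity applies. *)
Lemma continuous_natdiv f n : (0 < n)%N ->
  exists2 g, f = g *+ n & sup_norm g <= n%:R^-1 * sup_norm f.
Proof.
move=> n0; have cg : continuous (fun x => n%:R^-1 *: f x).
  by move=> x; apply: cvgZr; exact: cts_fun.
pose g : continuousType X E := mkcts cg; exists g.
  apply/continuousEP => x.
  have -> : forall h m, ((h : continuousType X E) *+ m) x = h x *+ m.
    by move=> h; elim=> [//|m IHm]; rewrite !mulrS -IHm.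
  by rewrite /= -scaler_nat scalerA divff ?scale1r// pnatr_eq0 -lt0n.
apply: sup_norm_le => [|x]; first by rewrite mulr_ge0 ?sup_norm_ge0.
rewrite /= normrZ ger0_norm//.
by rewrite ler_wpM2l// sup_norm_ub.
Qed.

Variable H : continuousType X E -> continuousType X E.

(** The induction starts at [n = 1]: the case [n = 0] would assert [H 0 = 0], which subadditivity
    alone does not give. *)
Lemma subadditive_map_natmul f n : (0 < n)%N -> subadditive_map H ->
  sup_norm (H (f *+ n)) <= n%:R * sup_norm (H f).
Proof.
move=> + Hadd; elim: n => [//|[|n] IHn] _; first by rewrite mulr1n mul1r.
rewrite mulrS (le_trans (Hadd _ _))// -nat1r mulrDl mul1r.
by rewrite lerD2l IHn.
Qed.

Lemma strongly_subadditive_le (M c : K) f : 0 <= M -> 0 <= c ->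
  strongly_subadditive M H -> (forall g, sup_norm (H g) <= c * sup_norm g) ->
  sup_norm (H f) <= c * M * sup_norm f.
Proof.
move=> M0 c0 [Hadd Hstr] Hc.
have H0 : H 0 = 0.
  by apply: sup_norm_eq0; rewrite (le_trans (Hc _))// sup_norm0 mulr0.
have [e e0 He] := Hstr 0.
(* At [f = 0] the right-hand side is [M * sup_norm (H (- g))], and the growth bound applied to [- g]
   supplies the factor [c]. *)
have Hsmall g : sup_norm g < e -> sup_norm (H g) <= c * M * sup_norm g.
  move=> ge; have := He g; rewrite H0 !sub0r !sup_normN => /(_ ge) /le_trans.
  apply; rewrite (mulrC c) -mulrA ler_wpM2l//.
  by rewrite (le_trans (Hc _))// sup_normN.
(* This [n] brings [f / n] into the ball of radius [e] where [Hsmall] applies. *)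
have [n fn] : exists n : nat, sup_norm f / e < n%:R.
  by apply: real_or_complex_archi; rewrite divr_ge0 ?sup_norm_ge0// ltW.
have n0 : 0 < n%:R :> K.
  by apply: le_lt_trans fn; rewrite divr_ge0 ?sup_norm_ge0// ltW.
have n0' : (0 < n)%N by rewrite -(ltr0n K).
have [g fg gf] := continuous_natdiv f n0'.
rewrite {1}fg (le_trans (subadditive_map_natmul _ _ _))//.
rewrite -ler_pdivlMl// (le_trans (Hsmall _ _))//.
  by apply: le_lt_trans gf _; rewrite ltr_pdivrMl// -ltr_pdivrMr.
by rewrite mulrCA ler_wpM2l// mulr_ge0.
Qed.

End RealOrComplex.

Theorem theorem3p2 (K : numFieldType) (hK : real_or_complex K)
    (X : topologicalType) (X_compact : compact [set: X])
    (X_hausdorff : hausdorff_space X) (E : unitalBanachAlgebra K)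
    (H : continuousType X E -> continuousType X E)
    (M : K) (M_gt0 : 0 < M) (H_strong : strongly_subadditive M H)
    (H_near : forall f : continuousType X E,
       exists2 e : K, 0 < e & sup_norm (H f - f) < e)
    (H_bound : exists c : K, [/\ 0 < c, 0 < c * M < 1 &
       forall f : continuousType X E, sup_norm (H f) <= c * sup_norm f]) :
  exists f0 : continuousType X E,
    [/\ H f0 = f0,
        forall f1 : continuousType X E, H f1 = f1 -> f1 = f0 &
        forall f : continuousType X E,
          sup_norm (iter n H f - f0) @[n --> \oo] --> (0 : K)].
Proof.
have [c [c0 /andP[cM0 cM1] Hc]] := H_bound.
have Hk f : sup_norm (H f) <= c * M * sup_norm f.
  by apply: (strongly_subadditive_le hK X_compact); rewrite ?ltW.
exists 0; split.
- apply: (sup_norm_eq0 hK X_compact).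
  by rewrite (le_trans (Hk _))// (sup_norm0 hK X_compact) mulr0.
- move=> f Hf; apply: (sup_norm_eq0 hK X_compact).
  (* For a fixed point the bound reads [(1 - c * M) * sup_norm f <= 0], with a positive first
     factor. *)
  have := Hk f; rewrite Hf -subr_le0 -[X in X - _]mul1r -mulrBl.
  by rewrite pmulr_rle0// subr_gt0.
- move=> f.
  have Hn n : sup_norm (iter n H f) <= sup_norm f * (c * M) ^+ n.
    elim: n => [|n IHn]; first by rewrite mulr1.
    rewrite iterS (le_trans (Hk _))// exprS mulrCA.
    by rewrite ler_wpM2l// ltW.
  have fk : sup_norm f * (c * M) ^+ n @[n --> \oo] --> (0 : K).
    apply: (real_or_complex_cvg_geometric hK); last by rewrite cM0.
    exact: sup_norm_ge0.
  (* Squeeze: any rank that works for the geometric bound works for the iterates. *)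
  apply/cvgrPdist_lt => e e0; have /cvgrPdist_lt/(_ e e0) := fk.
  apply: filterS => n; rewrite !sub0r !normrN subr0 => /le_lt_trans; apply.
  rewrite ger0_norm ?(sup_norm_ge0 hK X_compact)//.
  by rewrite (le_trans (Hn n))// real_ler_norm// ger0_real//
    mulr_ge0 ?(sup_norm_ge0 hK X_compact)// exprn_ge0// ltW.
Qed.
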